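(* For a nonempty directed poset $(\Gamma, \preceq)$, let $(R_\gamma)_{\gamma \in \Gamma}$ be a directed family of integral domains such that the extension $R_\alpha \subseteq R_\beta$ is inert for any $\alpha, \beta \in \Gamma$ with $\alpha \preceq \beta$. If $R_\gamma$ is a weak-ACCP domain for each $\gamma \in \Gamma$, then $\bigcup_{\gamma \in \Gamma} R_\gamma$ is a weak-ACCP domain.
   Context: A poset $(\Gamma,\preceq)$ is directed if for all $\alpha,\beta\in\Gamma$ there is $\theta\in\Gamma$ with $\alpha\preceq\theta$ and $\beta\preceq\theta$. A family $(R_\gamma)_{\gamma\in\Gamma}$ of integral domains is a directed family if $R_\alpha$ is a subring of $R_\beta$ whenever $\alpha\preceq\beta$; then $\bigcup_{\gamma\in\Gamma}R_\gamma$ is an integral domain, the directed union of the family. A ring extension $A \subseteq B$ of integral domains is inert if whenever $xy \in A$ for some $x,y \in B\setminus\{0\}$, there exists a unit $u \in B^\times$ such that $ux \in A$ and $u^{-1}y \in A$. An integral domain $R$ is atomic if every nonzero nonunit of $R$ is a finite product of irreducibles. An element $x\in R$ satisfies ACCP (in $R$) if every ascending chain of principal ideals of $R$ starting at $Rx$ eventually stabilizes. An integral domain $R$ is weak-ACCP if it is atomic and every nonempty finite subset $S$ of $R\setminus\{0\}$ has a common divisor $d\in R$ such that $\frac{s}{d}$ satisfies ACCP in $R$ for some $s\in S$. *)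

(* Defs.v *)
From HB Require Import structures.
From mathcomp Require Import all_boot all_order all_algebra.
From mathcomp Require Import boolp classical_sets cardinality.

Set Implicit Arguments.
Unset Strict Implicit.
Unset Printing Implicit Defensive.

Import Order.TTheory GRing.Theory.
Local Open Scope ring_scope.
Local Open Scope classical_set_scope.

Section Domain.
Variable R : idomainType.
Implicit Types x y d : R.

Definition principal_ideal x : set R := [set r * x | r in [set: R]].

Definition satisfies_ACCP x : Prop :=
  forall I : nat -> set R,
    (forall n, exists y, I n = principal_ideal y) ->
    I 0%N = principal_ideal x ->
    (forall n, I n `<=` I n.+1) ->
    exists N, forall n, (N <= n)%N -> I n = I N.

Definition irreducible x : Prop :=
  [/\ x != 0, x \isn't a GRing.unit &
      forall y z, x = y * z -> y \is a GRing.unit \/ z \is a GRing.unit].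

Definition atomic : Prop :=
  forall x, x != 0 -> x \isn't a GRing.unit ->
    exists2 s : seq R, (forall y, y \in s -> irreducible y) &
                       x = \prod_(y <- s) y.

Definition divides d x : Prop := exists q, x = q * d.

(* The quotient s / d is given as the q with s = q * d, since _^-1 is the
   identity on nonunits; q is unique because s, hence d, is nonzero. *)
Definition weak_ACCP : Prop :=
  atomic /\
  forall S : set R, finite_set S -> S !=set0 -> S `<=` [set x | x != 0] ->
    exists2 d, (forall s, S s -> divides d s) &
      exists s q, [/\ S s, s = q * d & satisfies_ACCP q].

End Domain.

Definition subdom (L : idomainType) (S : subringClosed L) : predArgType :=
  {x : L | x \in S}.

Section SubDomain.
Variables (L : idomainType) (S : subringClosed L).
Local Notation D := (subdom S).

HB.instance Definition _ := SubChoice.on D.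
HB.instance Definition _ := [SubChoice_isSubComNzRing of D by <:].

(* x is a unit of S when its inverse in L exists and lies in S. *)
Definition subdom_unit : {pred D} :=
  fun x => (val x \is a GRing.unit) && ((val x)^-1 \in S).
Definition subdom_inv (x : D) : D := insubd x (val x)^-1.

Fact subdom_mulVx : {in subdom_unit, left_inverse 1 subdom_inv *%R}.
Proof.
move=> x /andP[Ux Sx]; apply: val_inj.
by rewrite rmorphM rmorph1 /= insubdK // mulVr.
Qed.

Fact subdom_unitPl (x y : D) : y * x = 1 -> subdom_unit x.
Proof.
move=> /(congr1 val); rewrite rmorphM rmorph1 /= => yx1.
have Ux : val x \is a GRing.unit.
  by apply/unitrP; exists (val y); rewrite [val x * _]mulrC.
apply/andP; split => //.
by rewrite -[_^-1]mul1r -yx1 mulrK //; apply: valP.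
Qed.

Fact subdom_invr_out : {in [predC subdom_unit], subdom_inv =1 id}.
Proof.
move=> x; rewrite inE /= unfold_in /subdom_unit negb_and => nUx.
apply: val_inj; rewrite val_insubd; case: ifP => // Sx.
by move: nUx; rewrite Sx orbF => /invr_out.
Qed.

HB.instance Definition _ := GRing.ComNzRing_hasMulInverse.Build D
  subdom_mulVx subdom_unitPl subdom_invr_out.

Fact subdom_integral : GRing.integral_domain_axiom D.
Proof.
move=> x y /(congr1 val); rewrite rmorphM rmorph0 => /eqP.
by rewrite mulf_eq0 -!(rmorph0 (val : D -> L)) !(inj_eq val_inj).
Qed.

HB.instance Definition _ := GRing.ComUnitRing_isIntegral.Build D
  subdom_integral.

End SubDomain.

Definition inert (L : idomainType) (A B : subringClosed L) : Prop :=
  forall x y : subdom B, x != 0 -> y != 0 -> val (x * y) \in A ->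
    exists2 u : subdom B, u \is a GRing.unit &
      val (u * x) \in A /\ val (u^-1 * y) \in A.

Definition directed_poset (disp : Order.disp_t) (G : porderType disp) : Prop :=
  forall a b : G, exists c : G, (a <= c)%O /\ (b <= c)%O.

(* "R_a is a subring of R_b": both are subrings of the same domain L, so this
   amounts to inclusion. *)
Definition directed_family (disp : Order.disp_t) (G : porderType disp)
    (L : idomainType) (R : G -> subringClosed L) : Prop :=
  forall a b : G, (a <= b)%O -> {subset R a <= R b}.

Section DirectedUnion.
Variables (disp : Order.disp_t) (G : porderType disp) (L : idomainType).
Variable R : G -> subringClosed L.
Hypotheses (G0 : inhabited G) (Gdir : directed_poset G).
Hypothesis Rdir : directed_family R.

Definition union_pred : {pred L} := fun x => `[< exists a, x \in R a >].

Fact union_pred_subring : subring_closed union_pred.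
Proof.
have common x y : x \in union_pred -> y \in union_pred ->
    exists c, x \in R c /\ y \in R c.
  move=> /asboolP[a xa] /asboolP[b yb]; have [c [ac bc]] := Gdir a b.
  by exists c; split; [apply: Rdir ac _ xa | apply: Rdir bc _ yb].
split=> [|x y xU yU|x y xU yU].
- by case: G0 => a; apply/asboolP; exists a; apply: rpred1.
- by have [c [xc yc]] := common x y xU yU; apply/asboolP; exists c; apply: rpredB.
- by have [c [xc yc]] := common x y xU yU; apply/asboolP; exists c; apply: rpredM.
Qed.

Definition directed_union : subringClosed L :=
  HB.pack union_pred (GRing.isSubringClosed.Build L union_pred union_pred_subring).

End DirectedUnion.

(* Main.v *)
Require Import Defs.
From HB Require Import structures.
From mathcomp Require Import all_boot all_order all_algebra.
From mathcomp Require Import boolp classical_sets cardinality.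

(** The whole argument lives inside a single inert extension A <= B: a
    factorization in B of a nonzero element of A becomes, after moving a unit
    of B from one factor to the other, a factorization in A
    ([inert_factorization]).  Two consequences carry the theorem.

    An irreducible x of A need not stay irreducible in B, since it may become
    a unit (A = k[X] in B = k[X, 1/X] is inert); but this is the only
    obstruction, because a factorization of x in B is associated to one in A
    ([irreducible_incl]).  So a factorization into irreducibles of A is still
    one in B, up to a unit factor to be absorbed
    ([unit_or_irreducible_prod]).

    The ACCP passes from a nonzero element q of A to the same element of B:
    going up a chain of principal ideals of B starting at Bq, each generator
    divides the previous one, hence can be replaced by an associate in A that
    divides the previous generator already in A.  The resulting chain of A is
    stationary, hence so is the original one ([satisfies_ACCP_incl]).

    Each R_a is inert in the union, since a factorization in the union
    takes place in some R_c with a <= c, and any finite subset of the union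
    lies in a single R_a by directedness.  A common divisor found in R_a thus
    serves in the union. *)

Set Implicit Arguments.
Unset Strict Implicit.
Unset Printing Implicit Defensive.

Import Order.TTheory GRing.Theory.
Local Open Scope ring_scope.
Local Open Scope classical_set_scope.

(** * Factorizations and principal ideals up to units *)

Section Associates.
Variable R : idomainType.
Implicit Types (u x y d : R) (s : seq R).

Lemma principal_ideal_self x : principal_ideal x x.
Proof. by exists 1; rewrite ?mul1r. Qed.

Lemma principal_ideal_sub x y : divides y x ->
  principal_ideal x `<=` principal_ideal y.
Proof. by move=> [q ->] _ [r _ <-]; exists (r * q); rewrite ?mulrA. Qed.

Lemma principal_ideal_unitM u x : u \is a GRing.unit ->
  principal_ideal (u * x) = principal_ideal x.
Proof.
move=> Uu; apply/seteqP; split; apply: principal_ideal_sub; first by exists u.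
by exists u^-1; rewrite mulKr.
Qed.

Lemma irreducible_unitM u x : u \is a GRing.unit ->
  irreducible x -> irreducible (u * x).
Proof.
move=> Uu [x0 nUx irrx]; split; last 1 first.
- move=> y z uxE; have : x = (u^-1 * y) * z by rewrite -mulrA -uxE mulKr.
  by move=> /irrx; rewrite unitrMr ?unitrV.
- by rewrite mulf_neq0 //; apply: contraTneq Uu => ->; rewrite unitr0.
- by rewrite unitrMr.
Qed.

(** The unit factors collect into a single unit, which can be absorbed into an
    irreducible factor as soon as there is one. *)
Lemma unit_or_irreducible_prod s :
  (forall y, y \in s -> y \is a GRing.unit \/ irreducible y) ->
  \prod_(y <- s) y \isn't a GRing.unit ->
  exists2 t, (forall y, y \in t -> irreducible y) &
             \prod_(y <- s) y = \prod_(y <- t) y.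
Proof.
move=> s_ok.
have [u Uu [t irrt ->]] : exists2 u, u \is a GRing.unit &
    exists2 t, (forall y, y \in t -> irreducible y) &
               \prod_(y <- s) y = u * \prod_(y <- t) y.
  elim: s s_ok => [|x s IHs] s_ok.
    by exists 1; rewrite ?unitr1 //; exists [::]; rewrite ?big_nil ?mulr1.
  have [y ys|u Uu [t irrt sE]] := IHs; first by apply: s_ok; rewrite inE ys orbT.
  have [Ux|irrx] := s_ok x (mem_head x s).
    exists (x * u); first by rewrite unitrM Ux.
    by exists t => //; rewrite big_cons sE mulrA.
  exists u => //; exists (x :: t); last by rewrite !big_cons sE mulrCA.
  by move=> y /[!inE] /predU1P[->//|]; apply: irrt.
case: t irrt => [|y t] irrt; first by rewrite big_nil mulr1 Uu.
move=> _; exists (u * y :: t); last by rewrite !big_cons mulrA.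
move=> z /[!inE] /predU1P[->|zt]; last by apply: irrt; rewrite inE zt orbT.
by apply: irreducible_unitM => //; apply: irrt; rewrite mem_head.
Qed.

End Associates.

(** * Inert extensions *)

Section Inclusion.
Variables (L : idomainType) (A B : subringClosed L).
Hypothesis AB : {subset A <= B}.

Definition incl (x : subdom A) : subdom B := Sub (val x) (AB (valP x)).

Fact incl_is_zmod_morphism : zmod_morphism incl.
Proof. by move=> x y; apply: val_inj; rewrite !rmorphB. Qed.

Fact incl_is_monoid_morphism : monoid_morphism incl.
Proof.
by split=> [|x y]; apply: val_inj; rewrite /= ?rmorph1 ?rmorphM.
Qed.

HB.instance Definition _ :=
  GRing.isZmodMorphism.Build (subdom A) (subdom B) incl incl_is_zmod_morphism.
HB.instance Definition _ :=
  GRing.isMonoidMorphism.Build (subdom A) (subdom B) incl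
    incl_is_monoid_morphism.

Lemma incl_inj : injective incl.
Proof. by move=> x y /(congr1 val) xy; apply: val_inj. Qed.

Lemma incl_eq0 x : (incl x == 0) = (x == 0).
Proof. by rewrite -(rmorph0 incl) (inj_eq incl_inj). Qed.

Lemma incl_surj (y : subdom B) : val y \in A -> exists x, y = incl x.
Proof. by move=> yA; exists (Sub (val y) yA); apply: val_inj. Qed.

Hypothesis ABinert : inert A B.

Lemma inert_factorization (x : subdom A) (y z : subdom B) :
  x != 0 -> incl x = y * z ->
  exists2 u, u \is a GRing.unit & exists y' z',
    [/\ incl y' = u * y, incl z' = u^-1 * z & x = y' * z'].
Proof.
move=> x0 xE; move: (x0); rewrite -incl_eq0 xE mulf_eq0 negb_or.
move=> /andP[y0 z0]; have [|u Uu] := ABinert y0 z0.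
  by rewrite -xE; exact: (valP x).
move=> [/incl_surj[y' y'E] /incl_surj[z' z'E]].
exists u => //; exists y', z'; split=> //; apply: incl_inj.
by rewrite rmorphM /= -y'E -z'E mulrACA mulrV // mul1r.
Qed.

Lemma irreducible_incl (x : subdom A) : irreducible x ->
  incl x \is a GRing.unit \/ irreducible (incl x).
Proof.
move=> [x0 nUx irrx]; have [|nUix] := boolP (incl x \is a GRing.unit).
  by left.
right; split; rewrite ?incl_eq0 // => y z xE.
have [u Uu [y' [z' [y'E z'E /irrx]]]] := inert_factorization x0 xE.
case=> /(rmorph_unit incl).
  by rewrite /= y'E unitrMr //; left.
by rewrite /= z'E unitrMr ?unitrV //; right.
Qed.

Lemma atomic_incl (x : subdom A) : atomic (subdom A) ->
  x != 0 -> incl x \isn't a GRing.unit ->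
  exists2 s, (forall y, y \in s -> irreducible y) &
             incl x = \prod_(y <- s) y.
Proof.
move=> atA x0 nUx; have nUxA : x \isn't a GRing.unit.
  exact: contra (@rmorph_unit _ _ incl x) nUx.
have [s irrs xE] := atA x x0 nUxA; move: nUx.
rewrite xE rmorph_prod -(big_map incl predT id).
apply: unit_or_irreducible_prod => _ /mapP[y ys ->].
exact: irreducible_incl (irrs y ys).
Qed.

(** Inertness pulls the generators of the chain down to A one at a time: each
    must divide, within A, the pulled-down version of its predecessor, so they
    are chosen recursively. *)
Lemma satisfies_ACCP_incl (q : subdom A) : q != 0 ->
  satisfies_ACCP q -> satisfies_ACCP (incl q).
Proof.
move=> q0 accq I Iprinc I0 Isub.
pose generates n x := x != 0 /\ I n = principal_ideal (incl x).
have next n x : exists y, generates n x -> generates n.+1 y /\ divides y x.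
  have [[x0 InE]|] := pselect (generates n x); last by exists x.
  have [z InS] := Iprinc n.+1.
  have : I n.+1 (incl x).
    by apply: (Isub n); rewrite InE; apply: principal_ideal_self.
  rewrite InS => -[r _ /esym /(inert_factorization x0)].
  move=> [u Uu [r' [z' [_ z'E xE]]]].
  exists z' => _; split; last by exists r'.
  split; last by rewrite InS z'E principal_ideal_unitM ?unitrV.
  by apply: contraNneq x0 => z'0; rewrite xE z'0 mulr0.
have [g gP] := choice (fun nx : nat * subdom A => next nx.1 nx.2).
pose f := nat_rect (fun=> subdom A) q (fun n x => g (n, x)).
have fgen n : generates n (f n).
  by elim: n => [|n IHn]; [split | have [] := gP (n, f n) IHn].
have [| |n|N stable] := accq (fun n => principal_ideal (f n)).
- by move=> n; exists (f n).
- by [].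
- by apply: principal_ideal_sub; have [] := gP (n, f n) (fgen n).
have dvd_incl i j : principal_ideal (f i) = principal_ideal (f j) ->
    divides (incl (f j)) (incl (f i)).
  move=> ijE; have := principal_ideal_self (f i).
  by rewrite ijE => -[r _ <-]; exists (incl r); rewrite rmorphM.
exists N => n /stable nE; have [_ ->] := fgen n; have [_ ->] := fgen N.
by apply/seteqP; split; apply: principal_ideal_sub; apply: dvd_incl.
Qed.

End Inclusion.

(** * Directed unions *)

Section Union.
Variables (disp : Order.disp_t) (G : porderType disp).
Hypotheses (G0 : inhabited G) (Gdir : directed_poset G).
Variables (L : idomainType) (R : G -> subringClosed L).
Hypothesis Rdir : directed_family R.
Local Notation U := (directed_union G0 Gdir Rdir).

Lemma directed_unionP x : reflect (exists a, x \in R a) (x \in U).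
Proof. exact: asboolP. Qed.

Lemma sub_directed_union a : {subset R a <= U}.
Proof. by move=> x xa; apply/directed_unionP; exists a. Qed.

Lemma directed_union_seq_bound (s : seq (subdom U)) :
  exists a, forall x, x \in s -> val x \in R a.
Proof.
elim: s => [|x s [a sa]]; first by case: G0 => a; exists a.
have /directed_unionP[b xb] := valP x; have [c [ac bc]] := Gdir a b.
exists c => y /[!inE] /predU1P[->|ys]; first exact: Rdir bc _ xb.
exact: Rdir ac _ (sa y ys).
Qed.

(** A factorization in the union of an element of R a already takes place in
    some R c with a <= c, where inertness of R a provides the unit. *)
Lemma inert_directed_union :
  (forall a b, (a <= b)%O -> inert (R a) (R b)) -> forall a, inert (R a) U.
Proof.
move=> Rinert a x y x0 y0 xyA.
have [b xyb] := directed_union_seq_bound [:: x; y].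
have [c [ac bc]] := Gdir a b; pose i := incl (@sub_directed_union c).
have [x' xE] : exists x', x = i x'.
  by apply: incl_surj; apply: Rdir bc _ (xyb x _); rewrite !inE eqxx.
have [y' yE] : exists y', y = i y'.
  by apply: incl_surj; apply: Rdir bc _ (xyb y _); rewrite !inE eqxx orbT.
move: x0 y0 xyA; rewrite xE yE !incl_eq0 -rmorphM => x0 y0 xyA.
have [u Uu [uxA uyA]] := Rinert a c ac x' y' x0 y0 xyA.
exists (i u); first exact: rmorph_unit.
by rewrite -rmorphV // -!rmorphM.
Qed.

End Union.

Theorem proposition4p8 (disp : Order.disp_t) (G : porderType disp)
  (G0 : inhabited G) (Gdir : directed_poset G)
  (L : idomainType) (R : G -> subringClosed L) (Rdir : directed_family R)
  (Rinert : forall a b : G, (a <= b)%O -> inert (R a) (R b))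
  (RwACCP : forall a : G, weak_ACCP (subdom (R a))) :
  weak_ACCP (subdom (directed_union G0 Gdir Rdir)).
Proof.
have sub_U a : {subset R a <= directed_union G0 Gdir Rdir}.
  exact: sub_directed_union.
have inert_U a : inert (R a) (directed_union G0 Gdir Rdir).
  exact: inert_directed_union.
pose i a := incl (sub_U a).
split=> [x|S Sfin [x Sx] Sn0].
  have /directed_unionP[a /(incl_surj (sub_U a))[y ->]] := valP x.
  rewrite incl_eq0 => y0 nUy.
  by apply: atomic_incl => //; case: (RwACCP a).
have /finite_seqP[s sE] := Sfin.
have [a sa] := directed_union_seq_bound s.
have Slift y : S y -> exists z, y = i a z.
  by move=> Sy; apply: incl_surj; apply: sa; move: Sy; rewrite sE.
have [_] := RwACCP a; move=> /(_ (i a @^-1` S)).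
case=> [||y /Sn0|d dS [y [q [Sy yE accq]]]].
- by apply: finite_preimage => // y z _ _; apply: incl_inj.
- by have [z xE] := Slift x Sx; exists z; rewrite /= -xE.
- by rewrite /= incl_eq0.
exists (i a d) => [z Sz|].
  have [z' zE] := Slift z Sz.
  have [r rE] : divides d z' by apply: dS; rewrite /= -zE.
  by exists (i a r); rewrite zE rE /i rmorphM.
exists (i a y), (i a q); split=> //; first by rewrite yE /i rmorphM.
apply: satisfies_ACCP_incl => //.
by have := Sn0 _ Sy; rewrite /= incl_eq0 yE mulf_eq0 negb_or => /andP[].
Qed.
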